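(* Let $p$ be a prime congruent to $1$ modulo $3$ which satisfies condition (I). Suppose furthermore that $p$ is neither Exceptional $A$ nor Exceptional $B$. Then neither $3p$ nor $3p^{2}$ is a sum of two cubes in $\mathcal{K}$. (In particular the conclusion holds for all primes $p<100$ with $p\equiv 1\pmod 3$ other than $61$, $67$ and $73$.)
   Context: Let $u$ and $v$ be the two roots in $\mathbb{C}$ of $z^{2}+z+1=0$ (so $u,v$ are the primitive cube roots of unity). $\mathcal{O}$ is the set of $\mathbb{Z}$-linear combinations of $1,u,v$ (the ring of Eisenstein integers) and $\mathcal{K}$ is the set of $\mathbb{Q}$-linear combinations of $1,u,v$ (its field of fractions). A prime $p\equiv 1\pmod 3$ can be written as $p=\pi\bar\pi$ with $\pi\in\mathcal{O}$ irreducible, $\pi\equiv 1\pmod{3}$ in $\mathcal{O}$, and $\pi,\bar\pi$ not associates. For a prime $p\equiv1\pmod 3$: - Condition (I): writing $p=\pi\bar\pi$ with $\pi\equiv1\pmod 3$, $\bar{\pi}$ is a cube in the multiplicative group of the field $\mathcal{O}/\pi$. - $p$ is Exceptional $A$ if it has an irreducible factor $\pi$ in $\mathcal{O}$ with $\pi$ congruent modulo $9$ (in $\mathcal{O}$) to an integer (element of $\mathbb{Z}$). - $p$ is Exceptional $B$ if $3$ is a cube in $\mathbb{Z}/p$. *)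

(* Defs.v *)
From mathcomp Require Import all_boot all_order all_algebra.

Set Implicit Arguments.
Unset Strict Implicit.
Unset Printing Implicit Defensive.

Import Order.TTheory GRing.Theory Num.Theory.
Local Open Scope ring_scope.

Section Eisenstein.

Variables (C : numClosedFieldType) (u v : C).

Definition cube_root_pair : Prop :=
  forall z : C, z ^+ 2 + z + 1 = 0 <-> z = u \/ z = v.

Definition inO (z : C) : Prop :=
  exists a b c : int, z = a%:~R + b%:~R * u + c%:~R * v.

Definition inK (z : C) : Prop :=
  exists a b c : rat, z = ratr a + ratr b * u + ratr c * v.

Definition dvdO (x y : C) : Prop := exists2 c, inO c & y = c * x.

Definition eqmodO (m x y : C) : Prop := dvdO m (x - y).

Definition unitO (x : C) : Prop := inO x /\ exists2 y, inO y & x * y = 1.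

Definition assocO (x y : C) : Prop := exists2 e, unitO e & y = e * x.

Definition irreducibleO (x : C) : Prop :=
  [/\ inO x, x <> 0, ~ unitO x &
      forall a b, inO a -> inO b -> x = a * b -> unitO a \/ unitO b].

(* The class of x is a cube in the unit group of O / m: some t in O is
   invertible modulo m, with inverse s, and its cube is congruent to x. *)
Definition unit_cube_modO (m x : C) : Prop :=
  exists t s : C,
    [/\ inO t, inO s, eqmodO m (t * s) 1 & eqmodO m (t ^+ 3) x].

Definition primary_splitting (p : nat) (pi : C) : Prop :=
  [/\ irreducibleO pi, eqmodO 3 pi 1, ~ assocO pi pi^* & p%:R = pi * pi^*].

Definition conditionI (p : nat) : Prop :=
  exists2 pi : C, primary_splitting p pi & unit_cube_modO pi pi^*.

Definition exceptionalA (p : nat) : Prop :=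
  exists pi : C, [/\ irreducibleO pi, dvdO pi p%:R &
    exists n : int, eqmodO 9 pi n%:~R].

Definition sum_two_cubesK (z : C) : Prop :=
  exists x y : C, [/\ inK x, inK y & z = x ^+ 3 + y ^+ 3].

End Eisenstein.

(* For p prime, 'F_p is Z/p. *)
Definition exceptionalB (p : nat) : Prop := exists x : 'F_p, x ^+ 3 = 3%:R.

(* Main.v *)
Require Import Defs.
From mathcomp Require Import all_boot all_order all_algebra.
From mathcomp Require Import complex.
From mathcomp Require Import reals.
From mathcomp Require Import ring zify.

Set Implicit Arguments.
Unset Strict Implicit.
Unset Printing Implicit Defensive.

Import Order.TTheory GRing.Theory Num.Theory.
Local Open Scope ring_scope.

(* With [A = X + Y], [B = u X + v Y], [D = v X + u Y] a solution of
   [X^3 + Y^3 = 3 p^k Z^3] becomes a triple in [O] with sum [0] and product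
   [3 p^k z^3], [z] in [K]; we descend on the norm of the product.  Divide out
   the gcd, so that the entries are pairwise coprime, and let [j = 3 - k] and
   [s = sqrt (-3)].  Then [s], [pi] and its conjugate each divide exactly one
   entry.  Multiplying the entries by the powers [pi^j], [conj pi ^ j], [s] of
   the primes they already contain makes the product a cube without destroying
   coprimality, so each entry becomes a unit times a cube, and a congruence
   modulo 3 shows that the three units agree up to sign.  Let [s] divide [D].
   - If at most one of [pi] and its conjugate divides [A], and likewise for [B],
     and not both divide [D], a congruence modulo 9 forces [pi^j], its
     conjugate, or their difference to be an integer modulo 9; this contradicts
     "not Exceptional A".
   - If both divide [A] (or both [B]), then [Y^3 + 3 Z^3 = 0] modulo [pi] with
     [Y] invertible, so [3] is a cube modulo [p].
   - If both divide [D], then [A = e X^3], [B = e Y^3], and [X^3 + Y^3] yields a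
     triple of smaller norm. *)

(** * Rounding division and a size bound for integers *)

Lemma divz_nearest (a : int) (n : nat) : (0 < n)%N ->
  exists q r : int, a = q * n%:Z + r /\ 4 * r ^+ 2 <= n%:Z ^+ 2.
Proof.
move=> n_gt0.
(* The floor of [(2 a + n) / (2 n)] is the integer nearest to [a / n]. *)
have := divz_eq (2 * a + n%:Z) (2 * n%:Z).
have := @modz_ge0 (2 * a + n%:Z) (2 * n%:Z) ltac:(lia).
have := @ltz_pmod (2 * a + n%:Z) (2 * n%:Z) ltac:(lia).
set q := (_ %/ _)%Z; set r := (_ %% _)%Z => r_lt r_ge def_a.
exists q, (a - q * n%:Z); split; first by ring.
have := erefl (a - q * n%:Z); set t := {2 3}(a - _) => def_t; nia.
Qed.

(** A nonzero multiple [x = q P] would give [3 q^2 P <= 4], while [q^2 >= 1] and [P >= 2]. *)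
Lemma small_not_multiple (x q P : int) :
  1 < P -> 3 * x ^+ 2 <= 4 * P -> x <> 0 -> x <> q * P.
Proof.
move=> P1 bound x0 xq; rewrite xq in bound x0.
have q0 : q <> 0 by move=> q0; rewrite q0 mul0r in x0.
have q1 : 1 <= q ^+ 2 by clear - q0; nia.
have : 3 * q ^+ 2 * P <= 4.
  rewrite -(@ler_pM2r _ P) ?(lt_trans _ P1) //.
  by apply: le_trans bound; rewrite le_eqVlt; apply/orP; left; apply/eqP; ring.
clear - q1 P1; nia.
Qed.

(** * Arithmetic of the Eisenstein integers *)

Section EisensteinArithmetic.

Variables (C : numClosedFieldType) (u v : C).
Hypothesis uvP : cube_root_pair u v.

Local Notation O := (inO u v).
Local Notation dvd := (dvdO u v).
Local Notation unit := (unitO u v).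

Lemma sqr_cube_root : u ^+ 2 = - 1 - u.
Proof.
have u0 := (proj2 (uvP u)) (or_introl erefl).
by rewrite -[RHS]add0r -u0; ring.
Qed.

Lemma other_cube_root : v = - 1 - u.
Proof.
have [uv|<- //] : - 1 - u = u \/ - 1 - u = v by apply/uvP; ring: sqr_cube_root.
(* If [- 1 - u] were [u], the polynomial would have a double root; this writes its discriminant as
   [- 3]. *)
have : (3 : C) = 4 * (u ^+ 2 + 1 + u) - (u - (- 1 - u)) ^+ 2 by ring.
rewrite uv subrr expr0n subr0 sqr_cube_root (_ : _ + u = 0) ?mulr0; last by ring.
by move/eqP; rewrite pnatr_eq0.
Qed.

Lemma conj_cube_root : u^* = - 1 - u.
Proof.
have uc2 : u^* ^+ 2 + u^* + 1 = 0.
  rewrite -[X in _ + X]conjC1 -rmorphXn -!rmorphD sqr_cube_root.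
  by rewrite subrK addNr rmorph0.
have [uc|->] := (proj1 (uvP _)) uc2; last exact: other_cube_root.
(* The conjugate of [u] is again a root; if it were [u] itself, [u] would be real and
   [(2 u + 1)^2 = - 3] nonnegative. *)
have ur : u \is Num.real by apply/CrealP.
have : 0 <= (2 * u + 1) ^+ 2
  by rewrite real_exprn_even_ge0 // rpredD ?rpredM ?rpred1 ?rpred_nat.
have -> : (2 * u + 1) ^+ 2 = - 3%:R by ring: sqr_cube_root.
by rewrite oppr_ge0 lern0.
Qed.

Lemma inOP z : O z <-> exists a b : int, z = a%:~R + b%:~R * u.
Proof.
split=> [[a [b [c ->]]]|[a [b ->]]]; last first.
  by exists a, b, 0; rewrite mul0r addr0.
by exists (a - c), (b - c); rewrite other_cube_root; ring.
Qed.

Lemma inO_int (n : int) : O n%:~R.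
Proof. by apply/inOP; exists n, 0; rewrite mul0r addr0. Qed.

Lemma inO_nat (n : nat) : O n%:R.
Proof. exact: (inO_int n). Qed.

Lemma inO1 : O 1. Proof. exact: (inO_nat 1). Qed.
Lemma inO0 : O 0. Proof. exact: (inO_nat 0). Qed.

Lemma inO_root : O u.
Proof. by apply/inOP; exists 0, 1; rewrite add0r mul1r. Qed.

Lemma inOD x y : O x -> O y -> O (x + y).
Proof.
move=> /inOP[a [b ->]] /inOP[c [d ->]]; apply/inOP.
by exists (a + c), (b + d); ring.
Qed.

Lemma inON x : O x -> O (- x).
Proof. by move=> /inOP[a [b ->]]; apply/inOP; exists (- a), (- b); ring. Qed.

Lemma inOM x y : O x -> O y -> O (x * y).
Proof.
move=> /inOP[a [b ->]] /inOP[c [d ->]]; apply/inOP.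
by exists (a * c - b * d), (a * d + b * c - b * d); ring: sqr_cube_root.
Qed.

Lemma inOX x n : O x -> O (x ^+ n).
Proof.
by move=> Ox; elim: n => [|n IH]; rewrite ?expr0 ?exprS; [exact: inO1|exact: inOM].
Qed.

Lemma inO_conj x : O x -> O x^*.
Proof.
move=> /inOP[a [b ->]]; apply/inOP; exists (a - b), (- b).
by rewrite [LHS]rmorphD [X in _ + X]rmorphM !rmorph_int /= conj_cube_root; ring.
Qed.

Local Hint Resolve inO_int inO_nat inO1 inO0 inO_root : eis.
Local Hint Resolve inOD inON inOM inOX inO_conj : eis.
Local Ltac inO := solve [auto 20 with eis].

Definition eisnorm (z : C) : C := z * z^*.
Local Notation N := eisnorm.

Lemma eisnormE (a b : int) : N (a%:~R + b%:~R * u) = (a ^+ 2 - a * b + b ^+ 2)%:~R.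
Proof.
rewrite /eisnorm [X in _ * X]rmorphD [X in _ * (_ + X)]rmorphM !rmorph_int /=.
by rewrite conj_cube_root; ring: sqr_cube_root.
Qed.

Lemma eisnormM x y : N (x * y) = N x * N y.
Proof. by rewrite /eisnorm rmorphM /= mulrACA. Qed.

Lemma eisnorm_ge0 x : 0 <= N x.
Proof. exact: mul_conjC_ge0. Qed.

Lemma eisnorm_gt0 x : (0 < N x) = (x != 0).
Proof. exact: mul_conjC_gt0. Qed.

Lemma eisnorm_nat x : O x -> exists n : nat, N x = n%:R.
Proof.
move=> /inOP[a [b ->]]; rewrite eisnormE.
have : 0 <= a ^+ 2 - a * b + b ^+ 2 by nia.
by case: (_ + _) => // n _; exists n.
Qed.

(** The norm form is positive definite: [4 (x^2 - x y + y^2) = (2 x - y)^2 + 3 y^2]. *)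
Lemma eis_coord_inj (a b c d : int) :
  a%:~R + b%:~R * u = c%:~R + d%:~R * u -> a = c /\ b = d.
Proof.
move=> e; have : N ((a - c)%:~R + (b - d)%:~R * u) = 0.
  rewrite (_ : _ + _ = (a%:~R + b%:~R * u) - (c%:~R + d%:~R * u)); last by ring.
  by rewrite e subrr /eisnorm mul0r.
rewrite eisnormE => /eqP; rewrite intr_eq0 => /eqP form0.
have : (2 * (a - c) - (b - d)) ^+ 2 + 3 * (b - d) ^+ 2 = 0
  by rewrite -[RHS](mulr0 4) -form0; ring.
set X := 2 * _ - _; set Y := b - d => XY0.
have X0 : X = 0 by nia.
have Y0 : Y = 0 by nia.
by rewrite /X /Y in X0 Y0; lia.
Qed.

(** * Divisibility, Euclidean division and coprimality *)

Lemma dvdO_refl x : dvd x x.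
Proof. by exists 1; [inO|rewrite mul1r]. Qed.

Lemma dvdO_trans x y z : dvd x y -> dvd y z -> dvd x z.
Proof.
by move=> [c Oc ->] [d Od ->]; exists (d * c); [inO|rewrite mulrA].
Qed.

Lemma dvdO_mull c x y : O c -> dvd x y -> dvd x (c * y).
Proof. by move=> Oc [d Od ->]; exists (c * d); [inO|rewrite mulrA]. Qed.

Lemma dvdO_mulr c x y : O c -> dvd x y -> dvd x (y * c).
Proof. by rewrite mulrC; exact: dvdO_mull. Qed.

Lemma dvdOD x y z : dvd x y -> dvd x z -> dvd x (y + z).
Proof.
by move=> [c Oc ->] [d Od ->]; exists (c + d); [inO|rewrite mulrDl].
Qed.

Lemma dvdON x y : dvd x y -> dvd x (- y).
Proof. by move=> [c Oc ->]; exists (- c); [inO|rewrite mulNr]. Qed.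

Lemma dvdO_exp n x y : (0 < n)%N -> O y -> dvd x y -> dvd x (y ^+ n).
Proof.
by case: n => // n _ Oy xy; rewrite exprS; apply: dvdO_mulr; inO || exact xy.
Qed.

Lemma inO_divmod x y : O x -> O y -> y != 0 ->
  exists2 q, O q & N (x - q * y) < N y.
Proof.
move=> Ox Oy y0.
have [n Ny] := eisnorm_nat Oy.
have n0 : (0 < n)%N by rewrite -(ltr0n C) -Ny eisnorm_gt0.
have /inOP[a [b xy]] : O (x * y^*) by inO.
have [q1 [r1 [def_a r1s]]] := divz_nearest a n0.
have [q2 [r2 [def_b r2s]]] := divz_nearest b n0.
exists (q1%:~R + q2%:~R * u); first by inO.
have Nyc : N y^* = N y by rewrite /eisnorm conjCK mulrC.
(* Multiplying the remainder by the conjugate of [y] gives it the integer coordinates [r1], [r2], of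
   size at most [n / 2], hence norm at most [3 n^2 / 4]. *)
rewrite -(ltr_pM2l (_ : 0 < N y)) ?eisnorm_gt0 // -{1}Nyc -eisnormM.
have -> : y^* * (x - (q1%:~R + q2%:~R * u) * y) = r1%:~R + r2%:~R * u.
  rewrite mulrBr mulrC xy def_a def_b.
  have -> : y^* * ((q1%:~R + q2%:~R * u) * y) = (q1%:~R + q2%:~R * u) * N y.
    by rewrite /eisnorm; ring.
  by rewrite Ny; ring.
rewrite eisnormE Ny -natrM -[(n * n)%:R]/((n * n)%:Z%:~R) ltr_int.
by nia.
Qed.

(** Stated as a Bezout relation, so that products and divisors are handled by explicit
    combinations. *)
Definition coprimeO (x y : C) : Prop :=
  exists s t, [/\ O s, O t & s * x + t * y = 1].
Local Notation cop := coprimeO.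

Lemma inO_bezout x y : O x -> O y ->
  exists g, [/\ O g, dvd g x, dvd g y &
    exists s t, [/\ O s, O t & g = s * x + t * y]].
Proof.
move=> Ox Oy; have [n Ny] := eisnorm_nat Oy.
elim/ltn_ind: n x y Ox Oy Ny => n IH x y Ox Oy Ny.
have [->|y0] := eqVneq y 0.
  exists x; split=> //; first exact: dvdO_refl.
    by exists 0; [inO|rewrite mul0r].
  by exists 1, 0; split; [inO|inO|ring].
have [q Oq] := inO_divmod Ox Oy y0.
have Or : O (x - q * y) by inO.
have [m Nr] := eisnorm_nat Or; rewrite Nr Ny ltr_nat => m_lt.
have [g [Og gy gr [s [t [Os Ot def_g]]]]] := IH m m_lt y _ Oy Or Nr.
exists g; split=> //.
  by rewrite -(subrK (q * y) x); apply: dvdOD => //; exact: dvdO_mull.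
by exists t, (s - t * q); split; [inO|inO|rewrite def_g; ring].
Qed.

Lemma coprimeO_sym x y : cop x y -> cop y x.
Proof. by case=> s [t [Os Ot e]]; exists t, s; rewrite addrC. Qed.

Lemma coprimeO_mul x y z : O x -> O y -> O z -> cop x z -> cop y z -> cop (x * y) z.
Proof.
move=> Ox Oy Oz [s [t [Os Ot e]]] [s' [t' [Os' Ot' e']]].
exists (s * s'), (s * x * t' + t * s' * y + t * t' * z); split; [inO|inO|].
by rewrite -[1]mulr1 -{2}e -e'; ring.
Qed.

Lemma coprimeO_mulr x y z : O x -> O y -> O z -> cop x y -> cop x z -> cop x (y * z).
Proof.
move=> Ox Oy Oz /coprimeO_sym xy /coprimeO_sym xz.
by apply: coprimeO_sym; exact: coprimeO_mul.
Qed.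

Lemma coprimeO_exp n x z : O x -> O z -> cop x z -> cop (x ^+ n) z.
Proof.
move=> Ox Oz xz; elim: n => [|n IH].
  by exists 1, 0; split; [inO|inO|rewrite expr0; ring].
by rewrite exprS; apply: coprimeO_mul; inO || assumption.
Qed.

Lemma coprimeO_dvdl d x y : dvd d x -> cop x y -> cop d y.
Proof.
move=> [c Oc ->] [s [t [Os Ot e]]].
by exists (s * c), t; split=> //; [inO|rewrite -mulrA].
Qed.

Lemma coprimeO_dvdr d x y : dvd d y -> cop x y -> cop x d.
Proof. by move=> dy /coprimeO_sym /(coprimeO_dvdl dy) /coprimeO_sym. Qed.

Lemma coprimeO_common_dvd d x y : cop x y -> dvd d x -> dvd d y -> dvd d 1.
Proof.
move=> [s [t [Os Ot <-]]] dx dy.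
by apply: dvdOD; exact: dvdO_mull.
Qed.

Lemma coprimeO_gauss x y z : O y -> O z -> cop x y -> dvd x (y * z) -> dvd x z.
Proof.
move=> Oy Oz [s [t [Os Ot e]]] xyz.
have -> : z = s * z * x + t * (y * z) by rewrite -{1}[z]mul1r -e; ring.
by apply: dvdOD; [exists (s * z); [inO|]|exact: dvdO_mull].
Qed.

(** * Units and prime elements *)

Lemma unitO_eisnorm x : unit x <-> O x /\ N x = 1.
Proof.
split=> [[Ox [y Oy xy]]|[Ox Nx]]; last first.
  by split=> //; exists x^*; inO || exact: Nx.
split=> //; have [n Nx] := eisnorm_nat Ox; have [m Ny] := eisnorm_nat Oy.
have := eisnormM x y; rewrite xy Nx Ny /eisnorm conjC1 mul1r -natrM => /eqP.
by rewrite eq_sym pnatr_eq1 muln_eq1 => /andP[/eqP-> _].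
Qed.

Lemma unitO_mul x y : unit x -> unit y -> unit (x * y).
Proof.
move=> /unitO_eisnorm[Ox Nx] /unitO_eisnorm[Oy Ny]; apply/unitO_eisnorm.
by rewrite eisnormM Nx Ny mul1r; split=> //; inO.
Qed.

Lemma unitO_exp x n : unit x -> unit (x ^+ n).
Proof.
move=> ux; elim: n => [|n IH]; last by rewrite exprS; exact: unitO_mul.
by apply/unitO_eisnorm; rewrite expr0 /eisnorm conjC1 mul1r; split=> //; inO.
Qed.

Lemma unitO_norm x : unit x -> `|x| = 1.
Proof.
case/unitO_eisnorm=> _ Nx; apply/eqP; rewrite -sqrp_eq1 //.
by rewrite normCK; apply/eqP.
Qed.

Lemma unitO_neq0 x : unit x -> x != 0.
Proof. by move/unitO_norm => ux; rewrite -normr_eq0 ux oner_eq0. Qed.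

(* Two units differ by less than 3 in absolute value. *)
Lemma unitO_eqmod3 x y : unit x -> unit y -> dvd 3 (x - y) -> x = y.
Proof.
move=> ux uy [c Oc e].
have [n Nc] := eisnorm_nat Oc.
have : `|x - y| <= 2 by rewrite (le_trans (ler_normB _ _)) // !unitO_norm.
have Nc2 : `|c| ^+ 2 = n%:R by rewrite normCK.
rewrite e normrM normr_nat => c3.
have : `|c| ^+ 2 < 1.
  rewrite expr_lt1 // -(ltr_pM2r (ltr0n C 3)) (le_lt_trans c3) // mul1r.
  by rewrite ltr_nat.
rewrite Nc2 ltrn1 ltnS leqn0 => /eqP n0; apply/eqP; rewrite -subr_eq0 e.
by move: Nc2; rewrite n0 => /eqP; rewrite sqrf_eq0 normr_eq0 => /eqP->; rewrite mul0r.
Qed.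

(** This says that the ideal of [q] is maximal; Euclid's property follows in [primeO_dvd_mul]. *)
Definition primeO (q : C) : Prop :=
  [/\ O q, ~ dvd q 1 & forall x, O x -> dvd q x \/ cop q x].

(** The norm of [gcd(q, x)] divides [p], so this gcd is a unit or an associate of [q]. *)
Lemma primeO_eisnorm (p : nat) q : prime p -> O q -> N q = p%:R -> primeO q.
Proof.
move=> p_pr Oq Nq; split=> //.
  case=> c Oc e; have : unit q by split=> //; exists c => //; rewrite mulrC -e.
  case/unitO_eisnorm=> _; rewrite Nq => /eqP.
  by rewrite pnatr_eq1 => /eqP p1; rewrite p1 in p_pr.
move=> x Ox; have [g [Og [c Oc qc] gx [s [t [Os Ot def_g]]]]] := inO_bezout Oq Ox.
have [n Ng] := eisnorm_nat Og; have [m Nc] := eisnorm_nat Oc.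
have := Nq; rewrite {1}qc eisnormM Ng Nc -natrM => /eqP; rewrite eqr_nat => /eqP mn.
have [g1|n1] := eqVneq n 1%N.
  right; exists (g^* * s), (g^* * t); split; [inO|inO|].
  have gg : g * g^* = 1 by rewrite -[g * _]/(N g) Ng g1.
  rewrite (_ : _ + _ = g^* * (s * q + t * x)); last by ring.
  by rewrite -def_g mulrC.
left; have [_ p_dvd] := primeP p_pr.
have n_dvd : (n %| p)%N by rewrite -mn dvdn_mull.
have := p_dvd n n_dvd; rewrite (negbTE n1) /= -mn => /eqP nm.
have n0 : (0 < n)%N by move: (prime_gt0 p_pr); rewrite -mn muln_gt0 => /andP[].
have m1 : m = 1%N by nia.
apply: dvdO_trans gx; exists c^*; first by inO.
have cc : c * c^* = 1 by rewrite -[c * _]/(N c) Nc m1.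
by rewrite qc mulrA [c^* * c]mulrC cc mul1r.
Qed.

Lemma primeO_dvd_mul q x y : primeO q -> O x -> O y ->
  dvd q (x * y) -> dvd q x \/ dvd q y.
Proof.
case=> Oq _ qP Ox Oy qxy; have [|cqx] := qP x Ox; [by left|right].
exact: coprimeO_gauss qxy.
Qed.

Lemma primeO_dvd_exp q x n : primeO q -> O x -> dvd q (x ^+ n) -> dvd q x.
Proof.
move=> qP Ox; elim: n => [|n IH]; first by case: qP => _ q1 _; rewrite expr0.
by rewrite exprS => /primeO_dvd_mul -[] //; inO.
Qed.

Lemma primeO_not_coprime q x y : primeO q -> cop x y -> dvd q x -> ~ dvd q y.
Proof. by case=> _ q1 _ xy qx qy; case: q1; exact: coprimeO_common_dvd xy qx qy. Qed.

(** * The fraction field, and cube roots of elements of [O] *)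

Definition fracO (z : C) : Prop :=
  exists x y, [/\ O x, O y, y != 0 & z = x / y].

Lemma inO_fracO x : O x -> fracO x.
Proof. by exists x, 1; split; rewrite ?oner_neq0 ?divr1 //; inO. Qed.

Lemma fracOM x y : fracO x -> fracO y -> fracO (x * y).
Proof.
move=> [a [b [Oa Ob b0 ->]]] [c [d [Oc Od d0 ->]]].
exists (a * c), (b * d); split; [inO|inO|by rewrite mulf_neq0|].
by rewrite mulf_div.
Qed.

Lemma fracOV x : fracO x -> fracO x^-1.
Proof.
move=> [a [b [Oa Ob b0 ->]]].
have [->|a0] := eqVneq a 0; last by exists b, a; rewrite invf_div.
by rewrite mul0r invr0; apply: inO_fracO; inO.
Qed.

Lemma inK_fracO z : inK u v z -> fracO z.
Proof.
case=> a [b [c ->]].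
have d0 (r : rat) : (denq r)%:~R != 0 :> C by rewrite intr_eq0 denq_eq0.
exists ((numq a)%:~R * (denq b)%:~R * (denq c)%:~R
   + (numq b)%:~R * (denq a)%:~R * (denq c)%:~R * u
   + (numq c)%:~R * (denq a)%:~R * (denq b)%:~R * (- 1 - u)),
 ((denq a)%:~R * (denq b)%:~R * (denq c)%:~R).
split; [inO|inO|by rewrite !mulf_neq0|].
by rewrite other_cube_root /ratr; field; rewrite !d0.
Qed.

(** [O] is integrally closed: in lowest terms [w = x' / y'], the denominator divides
    [x'^3 = w^3 y'^3] and is coprime to it, so it is a unit. *)
Lemma inO_cube_root w : fracO w -> O (w ^+ 3) -> O w.
Proof.
move=> [x [y [Ox Oy y0 def_w]]] Ow3.
have [g [Og [x' Ox' ex] [y' Oy' ey] [s [t [Os Ot def_g]]]]] := inO_bezout Ox Oy.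
have g0 : g != 0 by apply: contra_neq y0 => g0; rewrite ey g0 mulr0.
have y'0 : y' != 0 by apply: contra_neq y0 => y'0; rewrite ey y'0 mul0r.
have {def_w} def_w : w = x' / y' by rewrite def_w ex ey -mulf_div divff // mulr1.
have xy' : cop x' y'.
  exists s, t; split=> //; apply: (mulfI g0).
  by rewrite mulr1 [RHS]def_g ex ey; ring.
have xw : x' = w * y' by rewrite def_w divfK.
have [c Oc e] : dvd y' 1.
  apply: (@coprimeO_common_dvd _ (x' ^+ 3) y').
  - by apply: coprimeO_exp.
  - rewrite xw exprMn [y' ^+ 3]exprS; apply: dvdO_mull => //.
    by apply: dvdO_mulr; [inO|exact: dvdO_refl].
  - exact: dvdO_refl.
have -> : w = x' * c by apply: (mulIf y'0); rewrite -mulrA -e mulr1.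
inO.
Qed.

(* With [g = gcd(a, c)], the ideal [(a, c)^3 = (a^3, a^2 c, a c^2, a b)] is
   [(a)], because [(a^2, b) = (1)]. *)
Lemma coprimeO_mul_eq_cube a b c : O a -> O b -> O c -> a != 0 ->
  cop a b -> a * b = c ^+ 3 -> exists e x, [/\ unit e, O x & a = e * x ^+ 3].
Proof.
move=> Oa Ob Oc a0 ab abc.
have [g [Og [a' Oa' ea] [c' Oc' ec] [s [t [Os Ot def_g]]]]] := inO_bezout Oa Oc.
have [x [y [Ox Oy e]]] := @coprimeO_exp 2 _ _ Oa Ob ab.
(* From [x a^2 + y b = 1] and [a b = c^3] comes [a = x a^3 + y c^3 = m g^3]. Expanding
   [g^3 = (s a + t c)^3] gives [g^3 = n a], so [m] and [n] are inverse units. *)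
pose m := x * a' ^+ 3 + y * c' ^+ 3.
pose n := s ^+ 3 * a ^+ 2 + 3 * s ^+ 2 * t * a * c + 3 * s * t ^+ 2 * c ^+ 2
  + t ^+ 3 * b.
have am : a = m * g ^+ 3.
  rewrite (_ : m * _ = x * (a' * g) ^+ 3 + y * (c' * g) ^+ 3); last by rewrite /m; ring.
  by rewrite -ea -ec -abc -[LHS]mulr1 -e; ring.
have gn : g ^+ 3 = n * a.
  have -> : g ^+ 3 = n * a + t ^+ 3 * (c ^+ 3 - a * b) by rewrite def_g /n; ring.
  by rewrite abc subrr mulr0 addr0.
exists m, g; split=> //; split; first by rewrite /m; inO.
exists n; first by rewrite /n; inO.
by apply: (mulIf a0); rewrite mul1r -mulrA -gn -am.
Qed.

(** * Cubes modulo 9 *)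

Definition sqrtm3 : C := 2 * u + 1.
Local Notation s := sqrtm3.

Lemma inO_sqrtm3 : O s.
Proof. by rewrite /s; inO. Qed.
Local Hint Resolve inO_sqrtm3 : eis.

Lemma sqr_sqrtm3 : s ^+ 2 = - 3%:R.
Proof. by rewrite /s; ring: sqr_cube_root. Qed.

Lemma sqrtm3_neq0 : s != 0.
Proof.
apply: contra_eq_neq sqr_sqrtm3 => ->.
by rewrite expr0n eq_sym oppr_eq0 pnatr_eq0.
Qed.

Lemma primeO_sqrtm3 : primeO s.
Proof.
apply: (@primeO_eisnorm 3) => //; first by inO.
by rewrite /s (_ : _ + _ = 1%:~R + 2%:~R * u) ?eisnormE //; ring.
Qed.

Lemma dvdO_sqrtm3_3 : dvd s 3.
Proof. by exists (- s); [inO|ring: sqr_sqrtm3]. Qed.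

Lemma dvdO_3_9 x : dvd 9 x -> dvd 3 x.
Proof. by apply: dvdO_trans; exists 3; [inO|ring]. Qed.

(** These are the elements [1 + s y]. As [s^2 = - 3], the cube is [1 + 3 s (y - y^3) - 9 y^2], and
    [s] divides [y - y^3]. The coordinate computation uses [b^3 = b] modulo 3 instead. *)
Lemma cube_mod9_1 (b k : int) :
  dvd 9 (((1 - b + 3 * k)%:~R + b%:~R * u) ^+ 3 - 1).
Proof.
have [m def_m] : exists m : int, b ^+ 3 = b + 3 * m.
  have := divz_eq b 3.
  have := @modz_ge0 b 3 isT; have := @ltz_pmod b 3 isT.
  set q := (_ %/ _)%Z; set r := (_ %% _)%Z => r_lt r_ge ->.
  have [->|[->|->]] : r = 0 \/ r = 1 \/ r = 2 by lia.
  - by exists (9 * q ^+ 3 - q); ring.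
  - by exists (9 * q ^+ 3 + 9 * q ^+ 2 + 2 * q); ring.
  by exists (9 * q ^+ 3 + 18 * q ^+ 2 + 11 * q + 2); ring.
have {}def_m : (b%:~R : C) ^+ 3 = b%:~R + 3 * m%:~R.
  by rewrite -rmorphXn /= def_m; ring.
exists ((m + k * (1 - b) ^+ 2 + 3 * k ^+ 2 * (1 - b) + 3 * k ^+ 3 - k * b ^+ 2)%:~R
  + (2 * m + b - b ^+ 2 + b * (k * (2 - 3 * b) + 3 * k ^+ 2))%:~R * u); first by inO.
by ring: sqr_cube_root def_m.
Qed.

Lemma cube_mod9 x : O x -> ~ dvd s x ->
  exists m : int, m ^+ 2 = 1 /\ dvd 9 (x ^+ 3 - m%:~R).
Proof.
move=> /inOP[a [b ->]] s_ndvd.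
have := divz_eq (a + b) 3.
have := @modz_ge0 (a + b) 3 isT; have := @ltz_pmod (a + b) 3 isT.
set q := (_ %/ _)%Z; set r := (_ %% _)%Z => r_lt r_ge ab.
(* Since [u] is 1 modulo [s], [r] is the class of [a + b u] in [O / s], the field with three
   elements. The class 2 reduces to the class 1 by changing sign. *)
have [r0|[r1|r2]] : r = 0 \/ r = 1 \/ r = 2 by lia.
- case: s_ndvd; exists (- q%:~R * s + b%:~R * (1 + u)); first by inO.
  have -> : a = 3 * q - b by lia.
  by rewrite /s; ring: sqr_cube_root.
- exists 1; split; first by ring.
  have -> : a = 1 - b + 3 * q by lia.
  exact: cube_mod9_1.
exists (-1); split; first by ring.
have [c Oc e] := cube_mod9_1 (- b) (- q - 1).
exists (- c); first by inO.
rewrite mulNr -e (_ : 1 - - b + _ = - a); last by lia.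
by ring.
Qed.

Lemma cube_mod3 x : O x -> exists m : int, dvd 3 (x ^+ 3 - m%:~R).
Proof.
move=> Ox; have [_ _ /(_ x Ox) [[c Oc ->]|cop_sx]] := primeO_sqrtm3.
  exists 0; exists (- s * c ^+ 3); first by inO.
  by ring: sqr_sqrtm3.
have [m [_ /dvdO_3_9 xm]] := cube_mod9 Ox (fun sx =>
  primeO_not_coprime primeO_sqrtm3 cop_sx (dvdO_refl s) sx).
by exists m.
Qed.

Lemma unit_not_dvd q x : primeO q -> unit x -> ~ dvd q x.
Proof.
move=> [_ q1 _] [Ox [y Oy e]] qx; apply: q1.
by rewrite -e; exact: dvdO_mulr.
Qed.

Lemma unitO_sign (m : int) : m ^+ 2 = 1 -> unit m%:~R.
Proof.
move=> m2; split; first by inO.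
by exists m%:~R; [inO|rewrite -intrM -expr2 m2].
Qed.

(** A unit is prime to [s], so its cube is a sign modulo 9, and units congruent modulo 3 are
    equal. *)
Lemma unitO_cube e : unit e -> exists m : int, m ^+ 2 = 1 /\ e ^+ 3 = m%:~R.
Proof.
move=> ue; have [m [m2 em]] := cube_mod9 (proj1 ue) (unit_not_dvd primeO_sqrtm3 ue).
exists m; split=> //; apply: unitO_eqmod3; [exact: unitO_exp|exact: unitO_sign|].
exact: dvdO_3_9.
Qed.

(** The factors bring in no new primes: [fx * x] divides [x ^+ m.+1] and [fy * y] divides
    [y ^+ n.+1]. *)
Lemma coprimeO_multiples x y fx fy m n : O x -> O y ->
  dvd fx (x ^+ m) -> dvd fy (y ^+ n) -> cop x y -> cop (fx * x) (fy * y).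
Proof.
move=> Ox Oy [gx Ogx ex] [gy Ogy ey] cop_xy.
apply: (@coprimeO_dvdl _ (x ^+ m.+1)).
  by exists gx => //; rewrite exprSr ex mulrA.
apply: (@coprimeO_dvdr _ _ (y ^+ n.+1)).
  by exists gy => //; rewrite exprSr ey mulrA.
apply: coprimeO_exp; [inO|inO|apply: coprimeO_sym].
by apply: coprimeO_exp => //; exact: coprimeO_sym.
Qed.

(* In the application [z] lies in [K] only; the factors [fa], [fb], [fc] complete
   the prime-to-3 part of [a * b * c] to a cube. *)
Section CoprimeTriple.

Variables (a b c fa fb fc z : C) (na nb nc : nat).
Hypotheses (Oa : O a) (Ob : O b) (Oc : O c).
Hypotheses (Ofa : O fa) (Ofb : O fb) (Ofc : O fc).
Hypotheses (fa1 : dvd 3 (fa - 1)) (fb1 : dvd 3 (fb - 1)) (fc1 : dvd 3 (fc - 1)).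
Hypotheses (fa_dvd : dvd fa (a ^+ na)) (fb_dvd : dvd fb (b ^+ nb))
  (fc_dvd : dvd fc (c ^+ nc)).
Hypotheses (cop_ab : cop a b) (cop_bc : cop b c) (cop_ac : cop a c).
Hypothesis (sum0 : a + b + c = 0).
Hypotheses (Fz : fracO z) (prodE : fa * a * (fb * b) * (fc * c) = 3 * z ^+ 3).
Hypothesis (prod0 : fa * a * (fb * b) * (fc * c) != 0).
Hypothesis (s_dvd : dvd s c).

Lemma coprime_triple_cubes : exists e X Y Z,
  [/\ unit e, O X /\ ~ dvd s X, O Y /\ ~ dvd s Y, O Z &
   [/\ fa * a = e * X ^+ 3, fb * b = e * Y ^+ 3 & fc * c = 3 * e * Z ^+ 3]].
Proof.
pose x := fa * a; pose y := fb * b; pose t := fc * c.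
have xyt : x * y * t = 3 * z ^+ 3 by exact: prodE.
have xyt0 : x * y * t != 0 by exact: prod0.
rewrite -/x -/y -/t.
have [Ox Oy Ot] : [/\ O x, O y & O t] by split; rewrite /x /y /t; inO.
have s0 := sqrtm3_neq0.
have [x0 y0 t0] : [/\ x != 0, y != 0 & t != 0].
  by move: xyt0; rewrite !mulf_eq0 !negb_or => /andP[/andP[]].
have cop_xy : cop x y by exact: coprimeO_multiples Oa Ob fa_dvd fb_dvd cop_ab.
have cop_xt : cop x t by exact: coprimeO_multiples Oa Oc fa_dvd fc_dvd cop_ac.
have cop_yt : cop y t by exact: coprimeO_multiples Ob Oc fb_dvd fc_dvd cop_bc.
have s_t : dvd s t by exact: dvdO_mull.
have cop_xs : cop x s := coprimeO_dvdr s_t cop_xt.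
have cop_ys : cop y s := coprimeO_dvdr s_t cop_yt.
(* Since [(- s)^3 = 3 s], the cube of [w] is [s x y t], a product of the pairwise coprime [x], [y]
   and [s t]. *)
pose w := - s * z.
have w3 : w ^+ 3 = x * (y * (s * t)).
  rewrite (_ : _ * (_ * _) = s * (x * y * t)); last by ring.
  by rewrite xyt /w; ring: sqr_sqrtm3.
have Ow : O w.
  apply: inO_cube_root; last by rewrite w3; inO.
  by apply: fracOM => //; apply: inO_fracO; inO.
have Ost : O (s * t) by inO.
have Os := inO_sqrtm3.
have cop_x : cop x (y * (s * t)).
  by apply: coprimeO_mulr => //; exact: coprimeO_mulr.
have cop_y : cop y (x * (s * t)).
  by apply: coprimeO_mulr => //; [exact: coprimeO_sym|exact: coprimeO_mulr].
have cop_st : cop (s * t) (x * y).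
  by apply: coprimeO_sym; apply: (coprimeO_mul Ox Oy Ost); exact: coprimeO_mulr.
have [e1 [X [ue1 OX ex]]] : exists e X, [/\ unit e, O X & x = e * X ^+ 3].
  by apply: (@coprimeO_mul_eq_cube x (y * (s * t)) w) => //; inO.
have [e2 [Y [ue2 OY ey]]] : exists e X, [/\ unit e, O X & y = e * X ^+ 3].
  by apply: (@coprimeO_mul_eq_cube y (x * (s * t)) w) => //; [inO|rewrite w3; ring].
have [e3 [Z [ue3 OZ et]]] : exists e X, [/\ unit e, O X & s * t = e * X ^+ 3].
  apply: (@coprimeO_mul_eq_cube (s * t) (x * y) w) => //; first by inO.
    by rewrite mulf_neq0.
  by rewrite w3; ring.
have [Z1 OZ1 eZ] : dvd s Z.
  have : dvd s (e3 * Z ^+ 3) by rewrite -et; apply: dvdO_mulr => //; exact: dvdO_refl.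
  case/(primeO_dvd_mul primeO_sqrtm3); [by case: ue3|by inO| |].
    by move/(unit_not_dvd primeO_sqrtm3 ue3).
  by apply: primeO_dvd_exp => //; exact: primeO_sqrtm3.
(* One factor [s] of [Z^3 = s^3 Z1^3] cancels, and the other two give [s^2 = - 3]; so 3 divides
   [t]. *)
have {}et : t = - 3%:R * e3 * Z1 ^+ 3.
  apply: (mulfI s0); rewrite et eZ; ring: sqr_sqrtm3.
have not_s x' e' X' : x' = e' * X' ^+ 3 -> O e' -> O X' -> cop x' s -> ~ dvd s X'.
  move=> ex' Oe' OX' /coprimeO_sym cop_s sX.
  apply: (primeO_not_coprime primeO_sqrtm3 cop_s).
    exact: dvdO_refl.
  by rewrite ex'; apply: dvdO_mull => //; exact: dvdO_exp.
have sX := not_s _ _ _ ex (proj1 ue1) OX cop_xs.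
have sY := not_s _ _ _ ey (proj1 ue2) OY cop_ys.
have [m1 [m1s [r1 Or1 eX]]] := cube_mod9 OX sX.
have [m2 [m2s [r2 Or2 eY]]] := cube_mod9 OY sY.
have signE (m : int) : m ^+ 2 = 1 -> (m%:~R : C) ^+ 2 = 1.
  by move=> ms; rewrite -rmorphXn ms.
have m1c := signE _ m1s; have m2c := signE _ m2s.
(* Modulo 3 the factors [fa], [fb], [fc] are 1, so [x + y + t] vanishes with [a + b + c]; also [t]
   is 0 and the cubes are [m1] and [m2]. The resulting congruence between two units is an
   equality. *)
have e12 : e1 * m1%:~R = - e2 * m2%:~R.
  apply: unitO_eqmod3.
  - by apply: unitO_mul => //; exact: unitO_sign.
  - apply: unitO_mul; last exact: unitO_sign.
    by case: ue2 => Oe2 [i Oi ei]; split; [inO|exists (- i); [inO|rewrite mulrNN]].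
  have [ra Ora ea] := fa1; have [rb Orb eb] := fb1; have [rc Orc ec] := fc1.
  exists (ra * a + rb * b + rc * c + e3 * Z1 ^+ 3 - 3 * e1 * r1 - 3 * e2 * r2).
    by case: (ue1) (ue2) (ue3) => ? _ [? _] [? _]; inO.
  apply/eqP; rewrite -subr_eq0; apply/eqP.
  have -> : m1%:~R = X ^+ 3 - r1 * 9 by rewrite -eX; ring.
  have -> : m2%:~R = Y ^+ 3 - r2 * 9 by rewrite -eY; ring.
  transitivity ((e1 * X ^+ 3 - x) + (e2 * Y ^+ 3 - y) + (- 3%:R * e3 * Z1 ^+ 3 - t)
    + (fa - 1 - ra * 3) * a + (fb - 1 - rb * 3) * b + (fc - 1 - rc * 3) * c
    + (a + b + c)).
    by rewrite /x /y /t; ring.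
  by rewrite -ex -ey -et ea eb ec sum0 !subrr; ring.
have [X0 Y0] : X != 0 /\ Y != 0.
  by split; [apply: contra_neq x0|apply: contra_neq y0] => V0;
    rewrite ?ex ?ey V0 expr0n mulr0.
have Z0 : Z != 0.
  apply: contra_neq t0 => Z0; move/eqP: eZ.
  by rewrite Z0 eq_sym mulf_eq0 (negbTE s0) orbF et => /eqP->; rewrite expr0n mulr0.
(* The product of the three units is the cube of [h], which is itself a unit of [O], hence this
   product is a sign. *)
have [m3 [m3s e123]] : exists m : int, m ^+ 2 = 1 /\ e1 * e2 * e3 = m%:~R.
  pose h := w / (X * Y * Z).
  have h3 : h ^+ 3 = e1 * e2 * e3.
    rewrite /h expr_div_n w3 ex ey.
    rewrite (_ : s * t = e3 * Z ^+ 3); last by rewrite et eZ; ring: sqr_sqrtm3.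
    by field; rewrite X0 Y0 Z0.
  have uh3 : unit (h ^+ 3) by rewrite h3; do 2?apply: unitO_mul.
  have Oh : O h.
    apply: inO_cube_root; last by case: uh3.
    apply: fracOM; first exact: inO_fracO.
    by apply: fracOV; apply: inO_fracO; inO.
  rewrite -h3; apply: unitO_cube; split=> //.
  have [_ [i Oi hi]] := uh3; exists (h ^+ 2 * i); first by inO.
  by rewrite -hi; ring.
have [m4 [m4s e13]] := unitO_cube ue1.
have m3c := signE _ m3s; have m4c := signE _ m4s.
have e2E : e2 = - m1%:~R * m2%:~R * e1.
  transitivity (- (- e2 * m2%:~R) * m2%:~R); first by ring: m2c.
  by rewrite -e12; ring.
have e3E : e3 = - m1%:~R * m2%:~R * m3%:~R * m4%:~R * e1.
  rewrite -e123 e2E; ring: e13 m1c m2c m4c.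
(* All three units are now [e1] up to sign, and a sign is its own cube, so it moves into [Y] or
   [Z1]. *)
exists e1, X, (- m1%:~R * m2%:~R * Y), (m1%:~R * m2%:~R * m3%:~R * m4%:~R * Z1).
split=> //.
- split; first by inO.
  have ums : unit (- m1%:~R * m2%:~R).
    by split; [inO|exists (- m1%:~R * m2%:~R); [inO|ring: m1c m2c]].
  case/(primeO_dvd_mul primeO_sqrtm3) => //; [by inO|].
  exact: unit_not_dvd primeO_sqrtm3 ums.
- by inO.
split=> //.
- by rewrite ey e2E; ring: m1c m2c.
- by rewrite et e3E; ring: m1c m2c m3c m4c.
Qed.

Lemma coprime_triple_mod9 : exists n : int, dvd 9 (fb - fa - n%:~R).
Proof.
have [e [X [Y [Z [ue [OX sX] [OY sY] OZ [ex ey ez]]]]]] := coprime_triple_cubes.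
have [m1 [m1s [r1 Or1 eX]]] := cube_mod9 OX sX.
have [m2 [m2s [r2 Or2 eY]]] := cube_mod9 OY sY.
have [n [r3 Or3 eZ]] := cube_mod3 OZ.
have [ra Ora ea] := fa1; have [rb Orb eb] := fb1; have [rc Orc ec] := fc1.
have {}ea : fa = 1 + ra * 3 by rewrite -ea; ring.
have {}eb : fb = 1 + rb * 3 by rewrite -eb; ring.
have {}ec : fc = 1 + rc * 3 by rewrite -ec; ring.
have eqn : fb * fc * X ^+ 3 + fa * fc * Y ^+ 3 + 3 * fa * fb * Z ^+ 3 = 0.
  apply: (mulfI (unitO_neq0 ue)); rewrite mulr0.
  transitivity (fa * fb * fc * (a + b + c)); last by rewrite sum0 mulr0.
  transitivity (fb * fc * (e * X ^+ 3) + fa * fc * (e * Y ^+ 3)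
    + fa * fb * (3 * e * Z ^+ 3)).
    by ring.
  by rewrite -ex -ey -ez; ring.
have {}eX : X ^+ 3 = m1%:~R + r1 * 9 by rewrite -eX; ring.
have {}eY : Y ^+ 3 = m2%:~R + r2 * 9 by rewrite -eY; ring.
have {}eZ : Z ^+ 3 = n%:~R + r3 * 3 by rewrite -eZ; ring.
rewrite {}eX {}eY {}eZ in eqn.
have m12 : (m1%:~R : C) = - m2%:~R.
  apply: unitO_eqmod3; [exact: unitO_sign| |].
    by rewrite -intrN; apply: unitO_sign; rewrite sqrrN.
  exists (- (fa * fb * (n%:~R + r3 * 3) + (rb + rc + 3 * rb * rc) * (m1%:~R + r1 * 9)
     + (ra + rc + 3 * ra * rc) * (m2%:~R + r2 * 9) + 3 * r1 + 3 * r2)); first by inO.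
  by apply/eqP; rewrite -subr_eq0 -eqn ea eb ec; apply/eqP; ring.
have m2c : (m2%:~R : C) ^+ 2 = 1 by rewrite -rmorphXn m2s.
exists (3 * n * m2).
exists (- rc * (rb - ra) + m2%:~R * (fb * fc * r1 + fa * fc * r2 + fa * fb * r3
  + (ra + rb + 3 * ra * rb) * n%:~R)); first by inO.
have {}eqn : m2%:~R * (fb * fc * (- m2%:~R + r1 * 9) + fa * fc * (m2%:~R + r2 * 9)
    + 3 * fa * fb * (n%:~R + r3 * 3)) = 0 by rewrite -m12 eqn mulr0.
apply/eqP; rewrite -subr_eq0 -oppr_eq0 -eqn; apply/eqP.
rewrite ea eb ec; ring: m2c.
Qed.

End CoprimeTriple.

Lemma dvdO_conj x y : dvd x y -> dvd x^* y^*.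
Proof. by move=> [c Oc ->]; exists c^*; [inO|rewrite rmorphM]. Qed.

Lemma dvdO_mod3_mul x y : O x -> dvd 3 (x - 1) -> dvd 3 (y - 1) -> dvd 3 (x * y - 1).
Proof.
move=> Ox x1 y1; rewrite (_ : _ - 1 = x * (y - 1) + (x - 1)); last by ring.
by apply: dvdOD => //; exact: dvdO_mull.
Qed.

Lemma dvdO_mod3_exp x n : O x -> dvd 3 (x - 1) -> dvd 3 (x ^+ n - 1).
Proof.
move=> Ox x1; elim: n => [|n IH]; first by exists 0; [inO|rewrite expr0; ring].
by rewrite exprS; exact: dvdO_mod3_mul.
Qed.

Lemma dvdO_exp2r x y n : O y -> dvd x y -> dvd (x ^+ n) (y ^+ n).
Proof. by move=> Oy [c Oc ->]; exists (c ^+ n); [inO|rewrite exprMn]. Qed.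

Definition eqint9 (x : C) : Prop := exists n : int, dvd 9 (x - n%:~R).

Lemma eqint9_coord (a b : int) :
  eqint9 (a%:~R + b%:~R * u) -> exists d : int, b = 9 * d.
Proof.
move=> [n [c /inOP[c1 [c2 ->]] e]].
have /eis_coord_inj[_ e2] : (a - n)%:~R + b%:~R * u = (9 * c1)%:~R + (9 * c2)%:~R * u.
  by transitivity (a%:~R + b%:~R * u - n%:~R); [ring|rewrite e; ring].
by exists c2.
Qed.

Lemma eqint9N x : eqint9 x -> eqint9 (- x).
Proof.
by move=> [n [c Oc e]]; exists (- n), (- c); [inO|rewrite mulNr -e; ring].
Qed.

(** * The descent *)

Section Descent.

Variables (p j k : nat) (pi : C).
Hypotheses (p_pr : prime p) (p_mod3 : p = 1 %[mod 3]).
Hypotheses (Opi : O pi) (pi_conj : p%:R = pi * pi^*) (pi1 : dvd 3 (pi - 1)).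
Hypotheses (pi_not_int : ~ eqint9 pi) (three_not_cube : ~ exceptionalB p).
(* [p ^+ k] is the power of [p] in [3 * p ^ k], and [p ^+ j] completes it to a cube. *)
Hypotheses (j_gt0 : (0 < j)%N) (k_gt0 : (0 < k)%N) (jk : (j + k = 3)%N).

Local Hint Resolve Opi : eis.

(** * The residue field of [pi], and powers of [pi] modulo 9 *)

Lemma primary_coord : exists m n : int,
  [/\ pi = (1 + 3 * m)%:~R + (3 * n)%:~R * u,
      p%:Z = (1 + 3 * m) ^+ 2 - (1 + 3 * m) * (3 * n) + (3 * n) ^+ 2
    & forall d, n <> 3 * d].
Proof.
have [c /inOP[m [n ->]] e] := pi1.
have def_pi : pi = (1 + 3 * m)%:~R + (3 * n)%:~R * u.
  by transitivity (pi - 1 + 1); [ring|rewrite e; ring].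
exists m, n; split=> //.
  apply/eqP; rewrite -(eqr_int C) -eisnormE -def_pi -[X in X == _]/(p%:R).
  by rewrite pi_conj.
(* If 3 divided [n], then [pi] would be the integer [1 + 3 m] modulo 9. *)
move=> d def_n; apply: pi_not_int; exists (1 + 3 * m), (d%:~R * u); first by inO.
by rewrite def_pi def_n; ring.
Qed.

Lemma eisnorm_pi : eisnorm pi = p%:R.
Proof. by rewrite pi_conj. Qed.

Lemma primeO_pi : primeO pi.
Proof. exact: primeO_eisnorm eisnorm_pi. Qed.

Lemma primeO_pi_conj : primeO pi^*.
Proof.
by apply: (primeO_eisnorm p_pr); [inO|rewrite /eisnorm conjCK mulrC pi_conj].
Qed.

(** Taking norms, [p] divides [n^2]. *)
Lemma dvdO_pi_int (n : int) : dvd pi n%:~R -> exists q : int, n = q * p%:Z.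
Proof.
move=> [c Oc e]; have [m Nc] := eisnorm_nat Oc.
have : eisnorm n%:~R = (m * p)%:R by rewrite e eisnormM Nc eisnorm_pi natrM.
rewrite /eisnorm rmorph_int -intrM -expr2 -[(m * p)%:R]/((m * p)%:Z%:~R).
move/eqP; rewrite eqr_int => /eqP n2.
have : (p %| `|n| ^ 2)%N.
  by rewrite -abszX n2 dvdn_mull.
rewrite Euclid_dvdX // andbT => p_n.
by have /dvdzP[q ->] : (p%:Z %| n)%Z; [exact: p_n|exists q].
Qed.

(** From [4 p = (2 (1 + 3 m) - 3 n)^2 + 3 (3 n)^2], the coordinate [3 n] is too small to be a
    nonzero multiple of [p]. *)
Lemma coord_not_dvd (m n q : int) :
  p%:Z = (1 + 3 * m) ^+ 2 - (1 + 3 * m) * (3 * n) + (3 * n) ^+ 2 ->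
  n <> 0 -> 3 * n <> q * p%:Z.
Proof.
move=> def_p n0 nq; have p2 := prime_gt1 p_pr.
have bound : 3 * (3 * n) ^+ 2 <= 4 * p%:Z.
  have : 0 <= (2 * (1 + 3 * m) - 3 * n) ^+ 2 by exact: sqr_ge0.
  by rewrite def_p; lia.
by apply: (@small_not_multiple _ q p%:Z) nq => //; lia.
Qed.

Lemma pi_not_dvd_sqrtm3 : ~ dvd pi s.
Proof.
move=> pi_s; have : dvd pi (s * s) by apply: dvdO_mull => //; exact: inO_sqrtm3.
rewrite -expr2 sqr_sqrtm3 => /dvdON; rewrite opprK => /(@dvdO_pi_int 3)[q q3].
have p_3 : (p%:Z %| 3)%Z by apply/dvdzP; exists q.
have p3 : p = 3%N by apply/eqP; rewrite -dvdn_prime2.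
by move: p_mod3; rewrite p3.
Qed.

(** Otherwise [pi] divides its difference with its conjugate, [3 n s], hence [3 n] or [s]. *)
Lemma pi_not_dvd_conj : ~ dvd pi pi^*.
Proof.
have [m [n [def_pi def_p n3]]] := primary_coord.
move=> pi_c; have : dvd pi (pi - pi^*).
  by apply: dvdOD; [exact: dvdO_refl|exact: dvdON].
have -> : pi - pi^* = (3 * n)%:~R * s.
  rewrite def_pi [X in _ - X]rmorphD [X in _ - (_ + X)]rmorphM !rmorph_int /=.
  rewrite conj_cube_root.
  by rewrite /s; ring.
case/(primeO_dvd_mul primeO_pi) => [| |/dvdO_pi_int[q]|]; [by inO|exact: inO_sqrtm3| |].
  by apply: coord_not_dvd def_p _ => n0; apply: (n3 0); rewrite n0.
exact: pi_not_dvd_sqrtm3.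
Qed.

Lemma pi_conj_not_dvd_sqrtm3 : ~ dvd pi^* s.
Proof.
move/dvdO_conj; rewrite conjCK => /dvdON pi_s; apply: pi_not_dvd_sqrtm3.
rewrite (_ : s = - s^*) //.
by rewrite /s rmorphD rmorphM rmorph1 rmorph_nat /= conj_cube_root; ring.
Qed.

Lemma pi_conj_not_dvd : ~ dvd pi^* pi.
Proof. by move/dvdO_conj; rewrite conjCK; exact: pi_not_dvd_conj. Qed.

(** [O / pi] is the prime field: as [3 n] is invertible modulo [p], with inverse [e], the relation
    [pi = 0] solves for [u] as [- e (1 + 3 m)]. *)
Lemma eqmod_pi_int x : O x -> exists n : int, dvd pi (x - n%:~R).
Proof.
move=> /inOP[c [d ->]].
have [m [n [def_pi def_p n3]]] := primary_coord.
have cop_np : coprimez (3 * n) p.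
  rewrite coprimez_sym coprimezE absz_nat prime_coprime //.
  apply/negP => p_n; have /dvdzP[q] : (p%:Z %| 3 * n)%Z by exact: p_n.
  by apply: coord_not_dvd def_p _ => n0; apply: (n3 0); rewrite n0.
have [e [f ef]] := Bezoutz (3 * n) p; rewrite (eqP cop_np) in ef.
have efC : e%:~R * (3 * n)%:~R + f%:~R * p%:R = 1 :> C.
  transitivity ((e * (3 * n) + f * p)%:~R : C); last by rewrite ef.
  by rewrite -[p%:R]/(p%:Z%:~R); ring.
exists (c - d * e * (1 + 3 * m)), (d%:~R * (e%:~R + f%:~R * pi^* * u)); first by inO.
transitivity (d%:~R * (e%:~R * ((1 + 3 * m)%:~R + (3 * n)%:~R * u)
  + f%:~R * u * (pi * pi^*))).
  transitivity (d%:~R * (e%:~R * (1 + 3 * m)%:~R)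
    + d%:~R * u * (e%:~R * (3 * n)%:~R + f%:~R * p%:R)).
    by rewrite efC; ring.
  by rewrite -pi_conj; ring.
by rewrite -def_pi; ring.
Qed.

(** If [pi] divides the sum, then [Z] has an inverse [t] modulo [pi], and [- t Y] has cube 3. An
    integer congruent to [- t Y] is then a cube root of 3 modulo [p]. *)
Lemma three_not_cube_mod_pi Y Z : O Y -> O Z -> ~ dvd pi Y ->
  ~ dvd pi (Y ^+ 3 + 3 * Z ^+ 3).
Proof.
move=> OY OZ piY piYZ.
have [_ _ /(_ Z OZ) [piZ|[x [t [Ox Ot e]]]]] := primeO_pi.
  apply/piY/(@primeO_dvd_exp _ _ 3 primeO_pi) => //.
  rewrite (_ : _ ^+ 3 = Y ^+ 3 + 3 * Z ^+ 3 + - (3 * Z ^+ 3)); last by ring.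
  by apply: dvdOD => //; apply/dvdON/dvdO_mull; [inO|exact: dvdO_exp].
have [n [c Oc en]] : exists n : int, dvd pi (- (t * Y) - n%:~R).
  by apply: eqmod_pi_int; inO.
have : dvd pi (n ^+ 3 - 3)%:~R.
  have [d Od ed] := piYZ.
  have eZ : t * Z = 1 - x * pi by rewrite -e; ring.
  have {}en : n%:~R = - (t * Y) - c * pi by rewrite -en; ring.
  exists (- t ^+ 3 * d + 3 * (- 3%:R * x + 3 * x ^+ 2 * pi - x ^+ 3 * pi ^+ 2)
    - c ^+ 3 * pi ^+ 2 - 3 * (t * Y) ^+ 2 * c - 3 * (t * Y) * c ^+ 2 * pi).
    by inO.
  transitivity ((- (t * Y) - c * pi) ^+ 3 - 3); first by rewrite -en; ring.
  transitivity (- t ^+ 3 * (Y ^+ 3 + 3 * Z ^+ 3) + 3 * ((t * Z) ^+ 3 - 1)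
     + ((- (t * Y) - c * pi) ^+ 3 + (t * Y) ^+ 3)); first by ring.
  by rewrite ed eZ; ring.
move=> /dvdO_pi_int[q nq]; apply: three_not_cube; exists n%:~R.
have : (n ^+ 3 - 3)%:~R = 0 :> 'F_p.
  by rewrite nq rmorphM /= -[p%:Z%:~R]/(p%:R) pchar_Fp_0 // mulr0.
by rewrite rmorphB rmorphXn /= => /eqP; rewrite subr_eq0 => /eqP.
Qed.

Lemma primary_pow_not_int : [/\ ~ eqint9 (pi ^+ j), ~ eqint9 (pi^* ^+ j) &
  ~ eqint9 (pi ^+ j - pi^* ^+ j)].
Proof.
have [m [n [def_pi def_p n3]]] := primary_coord.
have def_c : pi^* = (1 + 3 * m - 3 * n)%:~R + (- (3 * n))%:~R * u.
  rewrite def_pi [LHS]rmorphD [X in _ + X]rmorphM !rmorph_int /= conj_cube_root; ring.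
(* Each [u]-coordinate is [r (3 n)] modulo 9 with [r] prime to 3, so being 0 modulo 9 would force 3
   to divide [n]. *)
have contra (x : C) (a b c : int) :
    x = a%:~R + b%:~R * u ->
    (exists r, b = r * (3 * n) + 9 * c /\
       (r = 1 \/ r = -1 \/ r = 2 \/ r = -2 \/ r = 4)) ->
    ~ eqint9 x.
  move=> -> [r [-> r_val]] /eqint9_coord[d e].
  have [d' n_eq] : exists d', n = 3 * d'.
    by exists (n %/ 3)%Z; case: r_val => [?|[?|[?|[?|?]]]]; subst r; lia.
  exact: n3 n_eq.
have [j1|j2] : j = 1%N \/ j = 2%N by lia.
- rewrite j1 !expr1; split.
  + by apply: (contra _ (1 + 3 * m) (3 * n) 0) => //; exists 1; lia.
  + by apply: (contra _ (1 + 3 * m - 3 * n) (- (3 * n)) 0) => //; exists (-1); lia.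
  + apply: (contra _ (3 * n) (6 * n) 0); last by exists 2; lia.
    by rewrite def_c def_pi; ring.
rewrite j2; split.
- apply: (contra _ ((1 + 3 * m) ^+ 2 - (3 * n) ^+ 2)
    (2 * (1 + 3 * m) * (3 * n) - (3 * n) ^+ 2) (2 * m * n - n ^+ 2)).
    by rewrite def_pi; ring: sqr_cube_root.
  by exists 2; split; [ring|lia].
- apply: (contra _ ((1 + 3 * m - 3 * n) ^+ 2 - (3 * n) ^+ 2)
    (- (2 * (1 + 3 * m) * (3 * n) - (3 * n) ^+ 2)) (- (2 * m * n - n ^+ 2))).
    by rewrite def_c; ring: sqr_cube_root.
  by exists (-2); split; [ring|lia].
apply: (contra _ ((1 + 3 * m) ^+ 2 - (1 + 3 * m - 3 * n) ^+ 2)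
    (2 * (2 * (1 + 3 * m) * (3 * n) - (3 * n) ^+ 2)) (2 * (2 * m * n - n ^+ 2))).
  by rewrite def_c def_pi; ring: sqr_cube_root.
by exists 4; split; [ring|lia].
Qed.

(** * Triples and the primes that divide them *)

(** Letting [z] be a fraction keeps the notion stable under division by a gcd and under the descent
    step, which divides by [p]. *)
Definition triple (a b c : C) : Prop :=
  [/\ O a, O b, a + b + c = 0, a * b * c != 0 &
      exists2 z, fracO z & a * b * c = 3 * p%:R ^+ k * z ^+ 3].

Definition coprime_triple (a b c : C) : Prop :=
  [/\ triple a b c, cop a b, cop b c & cop a c].

Lemma triple_inO a b c : triple a b c -> O c.
Proof.
case=> Oa Ob sum0 _ _; have -> : c = (a + b + c) - a - b by ring.
by rewrite sum0; inO.
Qed.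

Lemma pnat_neq0 : p%:R != 0 :> C.
Proof. by rewrite pnatr_eq0 -lt0n prime_gt0. Qed.

(** The right side is [3 s p^3 z^3], the cube of [- s p z], and [O] contains the cube roots of its
    elements that lie in its fraction field. *)
Lemma triple_cube a b c : triple a b c ->
  exists2 w, O w & w ^+ 3 = s * p%:R ^+ j * (a * b * c).
Proof.
move=> tr; have Oc := triple_inO tr; have [Oa Ob _ _ [z Fz e]] := tr.
have w3 : (- s * p%:R * z) ^+ 3 = s * p%:R ^+ j * (a * b * c).
  have p3 : p%:R ^+ 3 = p%:R ^+ j * p%:R ^+ k :> C by rewrite -exprD jk.
  transitivity (- s ^+ 3 * p%:R ^+ 3 * z ^+ 3); first by ring.
  by rewrite p3 e; ring: sqr_sqrtm3.
have Os := inO_sqrtm3.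
exists (- s * p%:R * z) => //; apply: inO_cube_root; last by rewrite w3; inO.
by apply: fracOM => //; apply: inO_fracO; inO.
Qed.

Lemma p_mod3O : dvd 3 (p%:R - 1).
Proof.
exists (p %/ 3)%N%:R; first by inO.
by rewrite {1}(divn_eq p 3) p_mod3 modn_small // natrD natrM; ring.
Qed.

(** In [w^3 = s p^j a b c] the prime [s] occurs at least three times on the left; one factor cancels
    and [p] is prime to [s]. *)
Lemma sqrtm3_dvd_triple a b c : triple a b c -> dvd s (a * b * c).
Proof.
move=> tr; have Oc := triple_inO tr; have [w Ow e] := triple_cube tr.
have [Oa Ob _ _ _] := tr.
have Os := inO_sqrtm3; have sP := primeO_sqrtm3.
have [w' Ow' ew] : dvd s w.
  apply: (@primeO_dvd_exp s w 3) => //; rewrite e.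
  by do 2!(apply: dvdO_mulr; first by inO); exact: dvdO_refl.
have : dvd s (p%:R ^+ j * (a * b * c)).
  exists (s * w' ^+ 3); first by inO.
  by apply: (mulfI sqrtm3_neq0); rewrite [LHS]mulrA -e ew; ring.
case/(primeO_dvd_mul sP) => //; try by inO.
move=> sp; have [_ s1 _] := sP; case: s1.
have -> : 1 = p%:R ^+ j - (p%:R ^+ j - 1) :> C by ring.
apply: dvdOD => //; apply: dvdON; apply: dvdO_trans dvdO_sqrtm3_3 _.
by apply: dvdO_mod3_exp; [inO|exact: p_mod3O].
Qed.

(** In [w^3 = s q^j q'^j a b c] the cube contains [q^3]; cancelling [q^j] leaves [q^k] with [k > 0],
    and [q] divides neither [s] nor [q']. *)
Lemma prime_dvd_triple q q' a b c : triple a b c -> primeO q -> O q' ->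
  p%:R = q * q' -> ~ dvd q s -> ~ dvd q q' -> dvd q (a * b * c).
Proof.
move=> tr qP Oq' def_p q_s q_q'; have Oc := triple_inO tr.
have [w Ow e] := triple_cube tr; have [Oa Ob _ _ _] := tr; have [Oq _ _] := qP.
have Os := inO_sqrtm3.
have q0 : q != 0 by apply: contra_neq pnat_neq0 => q0; rewrite def_p q0 mul0r.
have [w' Ow' ew] : dvd q w.
  apply: (@primeO_dvd_exp q w 3) => //; rewrite e.
  apply: dvdO_mulr; first by inO.
  apply: dvdO_mull => //; apply: dvdO_exp => //; first by inO.
  by rewrite def_p; apply: dvdO_mulr => //; exact: dvdO_refl.
have : dvd q (s * q' ^+ j * (a * b * c)).
  exists (q ^+ k.-1 * w' ^+ 3); first by inO.
  apply: (mulfI (expf_neq0 j q0)).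
  transitivity (q ^+ (j + k) * w' ^+ 3); last first.
    by rewrite -(prednK k_gt0) exprD exprS; ring.
  rewrite jk; transitivity (w ^+ 3); last by rewrite ew; ring.
  by rewrite e def_p exprMn; ring.
case/(primeO_dvd_mul qP) => //; try by inO.
case/(primeO_dvd_mul qP) => //; try by inO.
by move/(primeO_dvd_exp qP Oq').
Qed.

(* Multiplying [x] by such an [f] preserves coprimality with the other entries
   of a triple. *)
Definition primary_factor (f x : C) : Prop :=
  [/\ O f, dvd 3 (f - 1) & exists n, dvd f (x ^+ n)].

Lemma triple_product a b c fa fb fc : triple a b c -> fa * fb * fc = p%:R ^+ j ->
  fa * a * (fb * b) * (fc * c) != 0 /\
  exists2 z, fracO z & fa * a * (fb * b) * (fc * c) = 3 * z ^+ 3.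
Proof.
move=> [_ _ _ prod0 [z Fz e]] fabc.
have -> : fa * a * (fb * b) * (fc * c) = p%:R ^+ j * (a * b * c) by rewrite -fabc; ring.
split; first by rewrite mulf_neq0 // expf_neq0 // pnat_neq0.
exists (p%:R * z); first by apply: fracOM => //; apply: inO_fracO; inO.
have p3 : p%:R ^+ 3 = p%:R ^+ j * p%:R ^+ k :> C by rewrite -exprD jk.
by rewrite e exprMn p3; ring.
Qed.

Lemma triple_mod9 a b c fa fb fc : coprime_triple a b c -> dvd s c ->
  primary_factor fa a -> primary_factor fb b -> primary_factor fc c ->
  fa * fb * fc = p%:R ^+ j -> eqint9 (fb - fa).
Proof.
move=> [tr ab bc ac] sc [Ofa fa1 [na fan]] [Ofb fb1 [nb fbn]] [Ofc fc1 [nc fcn]] fabc.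
have [prod0 [z Fz prodE]] := triple_product tr fabc.
have Oc := triple_inO tr; have [Oa Ob sum0 _ _] := tr.
exact: coprime_triple_mod9 Oa Ob Oc Ofa Ofb Ofc fa1 fb1 fc1 fan fbn fcn ab bc ac
  sum0 Fz prodE prod0 sc.
Qed.

Lemma triple_cubes a b c fa fb fc : coprime_triple a b c -> dvd s c ->
  primary_factor fa a -> primary_factor fb b -> primary_factor fc c ->
  fa * fb * fc = p%:R ^+ j -> exists e X Y Z,
  [/\ unit e, O X, O Y, O Z &
   [/\ fa * a = e * X ^+ 3, fb * b = e * Y ^+ 3 & fc * c = 3 * e * Z ^+ 3]].
Proof.
move=> [tr ab bc ac] sc [Ofa fa1 [na fan]] [Ofb fb1 [nb fbn]] [Ofc fc1 [nc fcn]] fabc.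
have [prod0 [z Fz prodE]] := triple_product tr fabc.
have Oc := triple_inO tr; have [Oa Ob sum0 _ _] := tr.
have [e [X [Y [Z [ue [OX _] [OY _] OZ eqs]]]]] :=
  coprime_triple_cubes Oa Ob Oc Ofa Ofb Ofc fa1 fb1 fc1 fan fbn fcn ab bc ac
    sum0 Fz prodE prod0 sc.
by exists e, X, Y, Z.
Qed.

Lemma primary_factor1 x : primary_factor 1 x.
Proof.
split; [inO|by exists 0; [inO|ring]|].
by exists 0%N; rewrite expr0; exact: dvdO_refl.
Qed.

Lemma primary_factor_exp q x : O q -> O x -> dvd 3 (q - 1) -> dvd q x ->
  primary_factor (q ^+ j) x.
Proof.
move=> Oq Ox q1 qx; split; [inO|exact: dvdO_mod3_exp|].
by exists j; exact: dvdO_exp2r.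
Qed.

Lemma primary_factorM f g x : primary_factor f x -> primary_factor g x ->
  primary_factor (f * g) x.
Proof.
move=> [Of f1 [m [d Od ed]]] [Og g1 [n [e Oe ee]]].
split; [inO|exact: dvdO_mod3_mul|].
by exists (m + n)%N, (d * e); [inO|rewrite exprD ed ee; ring].
Qed.

Lemma pi_conj1 : dvd 3 (pi^* - 1).
Proof.
have [c Oc e] := pi1; exists c^*; first by inO.
by transitivity (pi - 1)^*; [rewrite rmorphB rmorph1|rewrite e rmorphM rmorph_nat].
Qed.

Lemma pi_pow_mul : pi ^+ j * pi^* ^+ j = p%:R ^+ j.
Proof. by rewrite -exprMn -pi_conj. Qed.

Lemma triple_rot a b c : triple a b c -> triple b c a.
Proof.
move=> tr; have Oc := triple_inO tr; have [Oa Ob sum0 prod0 [z Fz e]] := tr.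
split=> //; first by rewrite -sum0; ring.
  by rewrite mulrAC mulrC mulrA in prod0 *; rewrite mulrAC.
by exists z => //; rewrite -e; ring.
Qed.

Lemma coprime_triple_rot a b c : coprime_triple a b c -> coprime_triple b c a.
Proof.
case=> tr ab bc ac; split=> //; first exact: triple_rot.
  exact: coprimeO_sym.
exact: coprimeO_sym.
Qed.

Lemma coprime_triple_swap a b c : coprime_triple a b c -> coprime_triple b a c.
Proof.
case=> -[Oa Ob sum0 prod0 [z Fz e]] ab bc ac; split=> //; last exact: coprimeO_sym.
split=> //; first by rewrite -sum0; ring.
  by rewrite [b * a]mulrC.
by exists z => //; rewrite -e; ring.
Qed.

(** * The cases of the descent *)

Lemma coprime_triple_not_same a b c : coprime_triple a b c -> dvd s c ->
  dvd pi a -> dvd pi^* a -> False.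
Proof.
move=> ct sc pa pca; have [tr ab _ _] := ct; have [Oa Ob sum0 _ _] := tr.
(* Attaching all of [p^j] to [a] leaves [b = e Y^3] and [c = 3 e Z^3], and [b + c = - a] vanishes
   modulo [pi]. *)
have [e [X [Y [Z [ue OX OY OZ [_ eb ec]]]]]] :
    exists e X Y Z, [/\ unit e, O X, O Y, O Z &
      [/\ p%:R ^+ j * a = e * X ^+ 3, 1 * b = e * Y ^+ 3 & 1 * c = 3 * e * Z ^+ 3]].
  apply: triple_cubes ct sc _ (primary_factor1 _) (primary_factor1 _) _; last by ring.
  rewrite -pi_pow_mul.
  by apply: primary_factorM; apply: primary_factor_exp => //; inO || exact: pi_conj1.
rewrite !mul1r in eb ec.
apply: (@three_not_cube_mod_pi Y Z) => //.
  move=> pY; apply: (primeO_not_coprime primeO_pi ab pa).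
  by rewrite eb; apply: dvdO_mull; [case: ue|exact: dvdO_exp].
have : dvd pi (e * (Y ^+ 3 + 3 * Z ^+ 3)).
  have -> : e * (Y ^+ 3 + 3 * Z ^+ 3) = - a + (a + b + c) by rewrite eb ec; ring.
  by rewrite sum0 addr0; exact: dvdON.
case/(primeO_dvd_mul primeO_pi) => //; [by case: ue|by inO|].
by move/(unit_not_dvd primeO_pi ue).
Qed.

Definition descends (t : C) : Prop :=
  exists a b c, triple a b c /\ eisnorm (a * b * c) < eisnorm t.

Lemma coprime_triple_descends a b c : coprime_triple a b c -> dvd s c ->
  dvd pi c -> dvd pi^* c -> descends (a * b * c).
Proof.
move=> ct sc pc pcc; have [tr ab _ _] := ct.
have Oc := triple_inO tr; have [Oa Ob sum0 prod0 _] := tr.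
have [e [X [Y [Z [ue OX OY OZ [ea eb ec]]]]]] :
    exists e X Y Z, [/\ unit e, O X, O Y, O Z &
      [/\ 1 * a = e * X ^+ 3, 1 * b = e * Y ^+ 3 & p%:R ^+ j * c = 3 * e * Z ^+ 3]].
  apply: triple_cubes ct sc (primary_factor1 _) (primary_factor1 _) _ _; last by ring.
  rewrite -pi_pow_mul.
  by apply: primary_factorM; apply: primary_factor_exp => //; inO || exact: pi_conj1.
rewrite !mul1r in ea eb.
have e0 := unitO_neq0 ue; have p0 := pnat_neq0.
have [Oe Ne] := (proj1 (unitO_eisnorm e)) ue.
have /andP[/andP[a0 b0] c0] : (a != 0) && (b != 0) && (c != 0).
  by move: prod0; rewrite !mulf_eq0 !negb_or.
have XYc : e * (X ^+ 3 + Y ^+ 3) = - c by rewrite -[RHS]add0r -sum0 ea eb; ring.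
have prodE :
    (X + Y) * (u * X + (- 1 - u) * Y) * ((- 1 - u) * X + u * Y) = X ^+ 3 + Y ^+ 3.
  by ring: sqr_cube_root.
have NXY : eisnorm (X ^+ 3 + Y ^+ 3) = eisnorm c.
  rewrite -[LHS]mul1r -Ne -eisnormM XYc.
  by rewrite /eisnorm rmorphN mulrNN.
(* The factors of [X^3 + Y^3 = - c / e] form the new triple, with product [3 p^k (- Z / p)^3] and
   the norm of [c]. *)
exists (X + Y), (u * X + (- 1 - u) * Y), ((- 1 - u) * X + u * Y); split.
  split; [inO|inO|by ring| |].
    by rewrite prodE -(mulrI_eq0 _ (mulfI e0)) XYc oppr_eq0.
  exists (- Z / p%:R).
    apply: fracOM; first by apply: inO_fracO; inO.
    by apply: fracOV; apply: inO_fracO; inO.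
  have p3 : p%:R ^+ 3 = p%:R ^+ j * p%:R ^+ k :> C by rewrite -exprD jk.
  rewrite prodE; apply: (mulfI (mulf_neq0 (expf_neq0 j p0) e0)).
  rewrite -mulrA XYc mulrN ec expr_div_n p3.
  by field; rewrite !expf_neq0.
rewrite prodE NXY [X in _ < X]eisnormM ltr_pMl ?eisnorm_gt0 // eisnormM.
have [n1 Na] := eisnorm_nat Oa; have [n2 Nb] := eisnorm_nat Ob.
have n1_gt0 : (0 < n1)%N by rewrite -(ltr0n C) -Na eisnorm_gt0.
have n2_gt0 : (0 < n2)%N by rewrite -(ltr0n C) -Nb eisnorm_gt0.
rewrite Na Nb -natrM ltr1n ltn_neqAle muln_gt0 n1_gt0 n2_gt0 eq_sym muln_eq1 !andbT.
(* The norm drops strictly unless [a] and [b] are both units. In that case 3 divides [c = - a - b],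
   so the units [a] and [- b] agree and [c = 0], which is excluded. *)
apply/negP => /andP[/eqP n11 /eqP n21]; rewrite n11 in Na; rewrite n21 in Nb.
have ua : unit a by apply/unitO_eisnorm.
have ub : unit (- b).
  by apply/unitO_eisnorm; split; [inO|rewrite /eisnorm rmorphN mulrNN].
have c3 : dvd 3 c.
  have [d Od ed] : dvd 3 (p%:R ^+ j - 1) by apply: dvdO_mod3_exp; [inO|exact: p_mod3O].
  exists (e * Z ^+ 3 - d * c); first by inO.
  transitivity (p%:R ^+ j * c - (p%:R ^+ j - 1) * c); first by ring.
  by rewrite ec ed; ring.
have ab_eq : a = - b.
  apply: unitO_eqmod3 => //; have -> : a - - b = - c + (a + b + c) by ring.
  by rewrite sum0 addr0; exact: dvdON.
move/eqP: c0; apply; have -> : c = (a + b + c) - (a + b) by ring.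
by rewrite sum0 ab_eq; ring.
Qed.

Lemma eqint9_sub1 x : eqint9 (x - 1) -> eqint9 x.
Proof.
move=> [n [c Oc e]]; exists (n + 1), c => //.
by rewrite -e; ring.
Qed.

Lemma dvdO_prod3 q a b c : primeO q -> O a -> O b -> O c -> dvd q (a * b * c) ->
  [\/ dvd q a, dvd q b | dvd q c].
Proof.
move=> qP Oa Ob Oc; case/(primeO_dvd_mul qP) => //; first by inO.
  by case/(primeO_dvd_mul qP) => // qx; [exact: Or31|exact: Or32].
by move=> qc; exact: Or33.
Qed.

Lemma coprime_triple_step a b c : coprime_triple a b c -> dvd s c ->
  descends (a * b * c).
Proof.
move=> ct sc; have [tr _ _ _] := ct; have Oc := triple_inO tr.
have [Oa Ob _ _ _] := tr; have Opc : O pi^* by inO.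
have [nP nPc nPPc] := primary_pow_not_int.
have F1 x := primary_factor1 x.
have Fp x : O x -> dvd pi x -> primary_factor (pi ^+ j) x.
  by move=> Ox; exact: primary_factor_exp.
have Fc x : O x -> dvd pi^* x -> primary_factor (pi^* ^+ j) x.
  by move=> Ox; apply: primary_factor_exp => //; exact: pi_conj1.
have mod9 := triple_mod9 ct sc.
have pE := pi_pow_mul.
have p_abc : dvd pi (a * b * c).
  apply: (prime_dvd_triple tr primeO_pi Opc pi_conj).
    exact: pi_not_dvd_sqrtm3.
  exact: pi_not_dvd_conj.
have pc_abc : dvd pi^* (a * b * c).
  apply: (prime_dvd_triple tr primeO_pi_conj Opi).
  - by rewrite pi_conj mulrC.
  - exact: pi_conj_not_dvd_sqrtm3.
  - exact: pi_conj_not_dvd.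
(* Nine cases, by the entries holding [pi] and its conjugate. Each prime power is attached to its
   entry, and [fb - fa] is then, up to sign, the difference of the two powers or of one power and
   1. *)
case: (dvdO_prod3 primeO_pi Oa Ob Oc p_abc) => px;
  case: (dvdO_prod3 primeO_pi_conj Oa Ob Oc pc_abc) => pcx.
- by case: (coprime_triple_not_same ct sc px pcx).
- case: nPPc; rewrite -[X in eqint9 X]opprB; apply: eqint9N.
  by apply: (mod9 _ _ 1 (Fp _ Oa px) (Fc _ Ob pcx) (F1 c)); rewrite mulr1.
- case: nP; apply: eqint9_sub1; rewrite -opprB; apply: eqint9N.
  by apply: (mod9 _ 1 _ (Fp _ Oa px) (F1 b) (Fc _ Oc pcx)); rewrite mulr1.
- case: nPPc; apply: (mod9 _ _ 1 (Fc _ Oa pcx) (Fp _ Ob px) (F1 c)).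
  by rewrite mulr1 mulrC.
- by case: (coprime_triple_not_same (coprime_triple_swap ct) sc px pcx).
- case: nP; apply: eqint9_sub1.
  by apply: (mod9 1 _ _ (F1 a) (Fp _ Ob px) (Fc _ Oc pcx)); rewrite mul1r.
- case: nPc; apply: eqint9_sub1; rewrite -opprB; apply: eqint9N.
  by apply: (mod9 _ 1 _ (Fc _ Oa pcx) (F1 b) (Fp _ Oc px)); rewrite mulr1 mulrC.
- case: nPc; apply: eqint9_sub1.
  by apply: (mod9 1 _ _ (F1 a) (Fc _ Ob pcx) (Fp _ Oc px)); rewrite mul1r mulrC.
exact: coprime_triple_descends.
Qed.

Lemma coprime_triple_smaller a b c : coprime_triple a b c -> descends (a * b * c).
Proof.
move=> ct; have [tr _ _ _] := ct; have Oc := triple_inO tr; have [Oa Ob _ _ _] := tr.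
case: (dvdO_prod3 primeO_sqrtm3 Oa Ob Oc (sqrtm3_dvd_triple tr)) => sx.
- rewrite (_ : a * b * c = b * c * a); last by ring.
  by apply: coprime_triple_step => //; exact: coprime_triple_rot.
- rewrite (_ : a * b * c = c * a * b); last by ring.
  by apply: coprime_triple_step => //; do 2!apply: coprime_triple_rot.
exact: coprime_triple_step.
Qed.

(** A common divisor [g] of [a] and [b] divides [c = - a - b]; dividing it out divides the product
    by [g^3] and [z] by [g]. *)
Lemma triple_coprime a b c : triple a b c -> exists a' b' c',
  coprime_triple a' b' c' /\ eisnorm (a' * b' * c') <= eisnorm (a * b * c).
Proof.
move=> tr; have [Oa Ob sum0 prod0 [z Fz e]] := tr.
have [g [Og [a' Oa' ea] [b' Ob' eb] [x [y [Ox Oy def_g]]]]] := inO_bezout Oa Ob.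
have g0 : g != 0 by apply: contra_neq prod0 => g0; rewrite ea g0 mulr0 !mul0r.
have xy1 : x * a' + y * b' = 1.
  by apply: (mulfI g0); rewrite mulr1 [RHS]def_g ea eb; ring.
have prodE : a * b * c = a' * b' * (- a' - b') * g ^+ 3.
  have -> : c = (a + b + c) - a - b by ring.
  by rewrite sum0 ea eb; ring.
have prod'0 : a' * b' * (- a' - b') != 0.
  by apply: contra_neq prod0 => prod'0; rewrite prodE prod'0 mul0r.
exists a', b', (- a' - b'); split.
  split.
  - split=> //; first by ring.
    exists (z / g).
      by apply: fracOM => //; apply: fracOV; exact: inO_fracO.
    apply: (mulIf (expf_neq0 3 g0)); rewrite -prodE e; field.
    by rewrite g0.
  - by exists x, y.
  - by exists (y - x), (- x); split; [inO|inO|rewrite -xy1; ring].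
  - by exists (x - y), (- y); split; [inO|inO|rewrite -xy1; ring].
have [n Ng] : exists n : nat, eisnorm (g ^+ 3) = n%:R by apply: eisnorm_nat; inO.
rewrite prodE [X in _ <= X]eisnormM Ng ler_peMr ?eisnorm_ge0 //.
by rewrite ler1n -(ltr0n C) -Ng eisnorm_gt0 expf_neq0.
Qed.

Lemma no_triple a b c : ~ triple a b c.
Proof.
move=> tr; have Oc := triple_inO tr; have [Oa Ob _ _ _] := tr.
have [n Nabc] : exists n : nat, eisnorm (a * b * c) = n%:R by apply: eisnorm_nat; inO.
elim/ltn_ind: n a b c tr Oa Ob Oc Nabc => n IH a b c tr Oa Ob Oc Nabc.
have [a' [b' [c' [ct le_abc]]]] := triple_coprime tr.
have [a1 [b1 [c1 [tr1 lt_abc]]]] := coprime_triple_smaller ct.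
have Oc1 := triple_inO tr1; have [Oa1 Ob1 _ _ _] := tr1.
have [m Nm] : exists m : nat, eisnorm (a1 * b1 * c1) = m%:R by apply: eisnorm_nat; inO.
apply: (IH m _ a1 b1 c1) => //.
by rewrite -(ltr_nat C) -Nm -Nabc; exact: lt_le_trans le_abc.
Qed.

Lemma not_sum_two_cubesK : ~ sum_two_cubesK u v (3 * p ^ k)%:R.
Proof.
move=> [x [y [/inK_fracO[X [m [OX Om m0 ->]]] /inK_fracO[Y [n [OY On n0 ->]]] e]]].
(* Clearing denominators multiplies both cubes by [(m n)^3], which goes into the [z] of the
   triple. *)
pose A := X * n; pose B := Y * m.
have AB : A ^+ 3 + B ^+ 3 = 3 * p%:R ^+ k * (m * n) ^+ 3.
  rewrite natrM natrX in e; rewrite e /A /B.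
  by field; rewrite m0 n0.
have prodE :
    (A + B) * (u * A + (- 1 - u) * B) * ((- 1 - u) * A + u * B) = A ^+ 3 + B ^+ 3.
  by ring: sqr_cube_root.
apply: (@no_triple (A + B) (u * A + (- 1 - u) * B) ((- 1 - u) * A + u * B)).
split; [by rewrite /A /B; inO|by rewrite /A /B; inO|by ring| |].
  by rewrite prodE AB !mulf_neq0 ?expf_neq0 ?mulf_neq0 ?pnat_neq0 // pnatr_eq0.
by exists (m * n); [apply: inO_fracO; inO|rewrite prodE].
Qed.

End Descent.
End EisensteinArithmetic.

(** * Explicit criteria and the primes below 100 *)

Lemma not_exceptionalB (p : nat) : prime p ->
  all (fun y => (y * y %% p * y) %% p != 3 %% p)%N (iota 0 p) -> ~ exceptionalB p.
Proof.
move=> p_pr /allP no_root [x x3].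
have x_lt : (x < p)%N by rewrite -[X in (_ < X)%N](Fp_cast p_pr).
have /negP[] := no_root x ltac:(by rewrite mem_iota).
(* The test reduces the square before the last product to keep its numbers small; [modnMml] undoes
   this. *)
rewrite modnMml -(val_Fp_nat p_pr) -(val_Fp_nat p_pr 3) -x3 -[x in x ^+ 3]natr_Zp.
by rewrite -natrX -mulnA.
Qed.

Lemma not_sum_two_cubes_primary (C : numClosedFieldType) (u v : C) (p : nat) (pi : C) :
  cube_root_pair u v -> prime p -> p = 1 %[mod 3] -> inO u v pi ->
  p%:R = pi * pi^* -> dvdO u v 3 (pi - 1) -> ~ eqint9 u v pi -> ~ exceptionalB p ->
  ~ sum_two_cubesK u v (3 * p)%:R /\ ~ sum_two_cubesK u v (3 * p ^ 2)%:R.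
Proof.
move=> uvP p_pr p_mod3 Opi pi_conj pi1 piA pB.
(* The two claims are [k = 1] with [j = 2], and [k = 2] with [j = 1]. *)
split; first rewrite -[p in (3 * p)%N]expn1.
  exact: (not_sum_two_cubesK (j := 2) uvP p_pr p_mod3 Opi pi_conj pi1 piA pB).
exact: (not_sum_two_cubesK (j := 1) uvP p_pr p_mod3 Opi pi_conj pi1 piA pB).
Qed.

(** A certificate for a concrete [p]: the norm equation, [n] modulo 3 and the search for cube roots
    of 3 can all be computed. *)
Lemma not_sum_two_cubes_coord (C : numClosedFieldType) (u v : C) (p : nat) (m n : int) :
  cube_root_pair u v -> prime p -> p = 1 %[mod 3] ->
  p%:Z = (1 + 3 * m) ^+ 2 - (1 + 3 * m) * (3 * n) + (3 * n) ^+ 2 ->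
  (n %% 3)%Z != 0 ->
  all (fun y => (y * y %% p * y) %% p != 3 %% p)%N (iota 0 p) ->
  ~ sum_two_cubesK u v (3 * p)%:R /\ ~ sum_two_cubesK u v (3 * p ^ 2)%:R.
Proof.
move=> uvP p_pr p_mod3 def_p n3 /(not_exceptionalB p_pr) pB.
apply: (@not_sum_two_cubes_primary _ u v p ((1 + 3 * m)%:~R + (3 * n)%:~R * u)) => //.
- by apply/(inOP uvP); exists (1 + 3 * m), (3 * n).
- by rewrite -[_ * _^*]/(eisnorm _) (eisnormE uvP) -def_p.
- exists (m%:~R + n%:~R * u); last by ring.
  by apply/(inOP uvP); exists m, n.
move=> /(eqint9_coord uvP)[d n_eq]; have {}n_eq : n = d * 3 by lia.
by rewrite n_eq modzMl in n3.
Qed.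

Theorem theorem2p3 (R : realType) (u v : R[i]) (uvP : cube_root_pair u v) :
  (forall p : nat, prime p -> p = 1 %[mod 3] ->
     conditionI u v p -> ~ exceptionalA u v p -> ~ exceptionalB p ->
     ~ sum_two_cubesK u v (3 * p)%:R /\ ~ sum_two_cubesK u v (3 * p ^ 2)%:R)
  /\
  (forall p : nat, prime p -> p = 1 %[mod 3] -> (p < 100)%N ->
     p \notin [:: 61; 67; 73]%N ->
     ~ sum_two_cubesK u v (3 * p)%:R /\ ~ sum_two_cubesK u v (3 * p ^ 2)%:R).
Proof.
split=> p p_pr p_mod3.
  move=> [pi [pi_irr pi1 _ pi_conj] _] pA.
  have [Opi _ _ _] := pi_irr.
  apply: (not_sum_two_cubes_primary uvP p_pr p_mod3 Opi pi_conj pi1 _) => // pi_int.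
  apply: pA; exists pi; split=> //.
  by exists pi^*; [exact: (inO_conj uvP Opi)|rewrite mulrC].
move=> p_lt p_notin.
(* Enumeration leaves eight primes, each settled by explicit coordinates of a factor. *)
have /allP/(_ p) : all (fun q =>
    prime q && (q %% 3 == 1) && (q \notin [:: 61; 67; 73]) ==>
    (q \in [:: 7; 13; 19; 31; 37; 43; 79; 97]))%N (iota 0 100) by vm_compute.
rewrite mem_iota p_lt => /(_ isT) /implyP.
rewrite p_pr p_notin p_mod3 => /(_ isT).
rewrite !inE => p_in.
have [m [n [def_p n3 no_root]]] : exists m n : int,
  [/\ p%:Z = (1 + 3 * m) ^+ 2 - (1 + 3 * m) * (3 * n) + (3 * n) ^+ 2, (n %% 3)%Z != 0 &
   all (fun y => (y * y %% p * y) %% p != 3 %% p)%N (iota 0 p)].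
  (* [pi = 1 + 3 (m + n u)] for each [p] *)
  move: p_in; do 7?[case/orP=> [/eqP->|]]; last move/eqP->.
  - by exists 0, 1; split=> //; vm_compute.
  - by exists 1, 1; split=> //; vm_compute.
  - by exists (-1), 1; split=> //; vm_compute.
  - by exists 0, 2; split=> //; vm_compute.
  - by exists 2, 1; split=> //; vm_compute.
  - by exists 2, 2; split=> //; vm_compute.
  - by exists 3, 1; split=> //; vm_compute.
  - by exists (-3), 1; split=> //; vm_compute.
exact: not_sum_two_cubes_coord uvP p_pr p_mod3 def_p n3 no_root.
Qed.
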